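(* Consider a Petrov-Galerkin MsFEM in the general framework described in the context, with either DOF-extended ($\bullet=\mathsf e$) or DOF-continuous ($\bullet=\mathsf c$) multiscale basis functions: find $u_H^\varepsilon\in V_{H,0}^\varepsilon$ such that $$\sum_{K\in\mathcal T_H} a_K^\varepsilon(u_H^\varepsilon,v_H)=F(v_H)\quad\text{for all } v_H\in V_{H,0},$$ with matrix $\mathbb A^\varepsilon_{j,i}=\sum_{K\in\mathcal T_H}a_K^\varepsilon(\phi_i^\varepsilon,\phi_j)$, $1\le i,j\le N_0$. For $K\in\mathcal T_H$ define on $K$ the constants ($1\le\alpha,\beta\le d$) $$\overline M|_K=\tfrac1{|K|}a_K^\varepsilon(W_K^0,1),\quad \overline B^1_\alpha|_K=\tfrac1{|K|}a_K^\varepsilon(W_K^\alpha,1),\quad \overline B^2_\beta|_K=\tfrac1{|K|}a_K^\varepsilon(W_K^0,x^\beta-x^\beta_{c,K}),\quad \overline A_{\beta,\alpha}|_K=\tfrac1{|K|}a_K^\varepsilon(W_K^\alpha,x^\beta-x^\beta_{c,K}),$$ and the effective bilinear forms $$\overline a_K(u,v)=\int_K \nabla v\cdot\overline A\,\nabla u+v\,(\overline B^1\cdot\nabla u)+u\,(\overline B^2\cdot\nabla v)+\overline M\,u\,v .$$ Let $\mathbb A^{P_1}_{j,i}=\sum_{K}\overline a_K(\phi_i,\phi_j)$, $1\le i,j\le N_0$, where each integral over $K$ in $\overline a_K$ is evaluated by the one-point quadrature rule at the centroid, i.e. $\int_K g$ is replaced by $|K|\,g(x_{c,K})$. Then $\mathbb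 A^\varepsilon=\mathbb A^{P_1}$. Moreover, the Petrov-Galerkin MsFEM coincides with solving the effective problem: find $u_H\in V_{H,0}$ such that $\sum_{K}\overline a_K(u_H,v_H)=F(v_H)$ for all $v_H\in V_{H,0}$ (with the integrals in $\overline a_K$ evaluated at the centroids, $F$ being evaluated exactly), followed by the post-processing step $$u_H^\varepsilon|_K=u_H(x_{c,K})\,W_K^0+\sum_{\alpha=1}^d(\partial_\alpha u_H)|_K\,W_K^\alpha\quad\text{for all }K\in\mathcal T_H;$$ that is, $u_H^\varepsilon\in V_{H,0}^\varepsilon$ solves the Petrov-Galerkin MsFEM if and only if it is obtained by this post-processing from a solution $u_H\in V_{H,0}$ of the effective problem.
   Context: Problem. $\Omega\subset\mathbb R^d$ ($d\ge1$) is a bounded polytope and $\mathcal T_H$ a conformal simplicial mesh of $\Omega$. $H^1(\mathcal T_H)=\{u\in L^2(\Omega): u|_K\in H^1(K)\ \forall K\in\mathcal T_H\}$; $P_1(\mathcal T_H)$ is the space of functions that are affine on each $K\in\mathcal T_H$. For each $K\in\mathcal T_H$, $a_K^\varepsilon$ is a continuous bilinear form on $H^1(K)\times H^1(K)$, and $a^\varepsilon=\sum_K a_K^\varepsilon$ is coercive on $H_0^1(\Omega)$. Moreover for each $K$ there is $\alpha_K>0$ with $a_K^\varepsilon(u,u)\ge\alpha_K\|\nabla u\|_{L^2(K)}^2$ for all $u\in H^1(K)$. $f\in L^2(\Omega)$ and $F(v)=\int_\Omega f v$. $x_{c,K}$ is the centroid of $K$, $x^\alpha$ the $\alpha$-th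 coordinate function, $x_{c,K}^\alpha$ the $\alpha$-th coordinate of $x_{c,K}$. Underlying $P_1$ space and degrees of freedom. $V_H$ is one of: (MsFEM-lin) the space of functions in $P_1(\mathcal T_H)$ continuous on $\Omega$; (MsFEM-CR) the Crouzeix-Raviart space of $v\in P_1(\mathcal T_H)$ whose jump has zero integral over every interior face. For a simplex $K$ and $v\in P_1(K)$, the degree-of-freedom (DOF) operator $\Gamma(K,v)\in\mathbb R^{d+1}$ is the vector of values of $v$ at the $d+1$ vertices of $K$ (MsFEM-lin), or of averages of $v$ over the $d+1$ faces of $K$ (MsFEM-CR). The degrees of freedom attached to mesh vertices (resp. faces) lying on $\partial\Omega$ are said to be associated to the boundary. $V_{H,0}$ is the space of $v\in V_H$ all of whose degrees of freedom associated to the boundary vanish. $\phi_1,\dots,\phi_N$ is the basis of $V_H$ dual to the vertices (lin) or to the faces (CR) of the mesh (value, resp. face average, $\delta_{ij}$), ordered so that $\phi_1,\dots,\phi_{N_0}$ is a basis of $V_{H,0}$. Oversampling. For each $K\in\mathcal T_H$, $S_K=S_K'\cap\Omega$ where $S_K'$ is the image of $K$ under a homothety centred at the centroid of $K$ with ratio $\rho\ge1$. If $S_K=K$ for all $K$ the method is ''without oversampling''. $\Gamma(S_K,v)$, $v\in P_1(S_K)$, is: (lin) the values of $v$ at $d+1$ chosen distinct vertices of $S_K$; (CR) the averages of $v$ over the $d+1$ dilated faces of $S_K$, where the faces of $S_K$ that collapse to a single vertex when $S_K$ is shrunk to $K$ are called additional and the others dilated ($S_K$ is assumed to have $d+1$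 dilated faces). $\Gamma(S_K,\cdot)$ is a linear bijection $P_1(S_K)\to\mathbb R^{d+1}$. Sampling space and form. For each $K$, $V_K\subset H^1(S_K)$ is a subspace and $s_K^\varepsilon:V_K\times V_K\to\mathbb R$ a bilinear form such that: $P_1(S_K)\subset V_K$; $\Gamma(S_K,\cdot)$ is well-defined on $V_K$; and, with $V_{K,0}=\{w\in V_K:\Gamma(S_K,w)=0\}$, for every $g\in(H^1(S_K))'$ and every prescribed value of $\Gamma(S_K,v)$ there is a unique $v\in V_K$ with $s_K^\varepsilon(v,w)=\langle g,w\rangle$ for all $w\in V_{K,0}$ and $\Gamma(S_K,v)$ equal to the prescribed value. Numerical correctors. The corrector equations for $\chi_{S_K}^\alpha\in V_K$ are: for all $w\in V_{K,0}$, $s_K^\varepsilon(\chi_{S_K}^0,w)=-s_K^\varepsilon(1,w)$ for $\alpha=0$, and $s_K^\varepsilon(\chi_{S_K}^\alpha,w)=-s_K^\varepsilon(x^\alpha-x^\alpha_{c,K},w)$ for $1\le\alpha\le d$. The DOF-extended corrector $\chi_{S_K}^{\alpha,\mathsf e}$ is the unique solution in $V_{K,0}$ (i.e. $\Gamma(S_K,\chi_{S_K}^{\alpha,\mathsf e})=0$). The DOF-continuous corrector $\chi_{S_K}^{\alpha,\mathsf c}$ is the unique solution in $V_K$ with $\Gamma(K,\chi_{S_K}^{\alpha,\mathsf c})=0$; when DOF-continuous correctors are used, $\Gamma(K,\cdot)$ is assumed well-defined on $V_K$ and the problem of finding $v\in V_K$ with $s_K^\varepsilon(v,w)=\langle g,w\rangle$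 for all $w\in V_{K,0}$ and $\Gamma(K,v)$ prescribed is assumed well-posed. For $\bullet\in\{\mathsf e,\mathsf c\}$, $\chi_K^{\alpha,\bullet}$ is the restriction of $\chi_{S_K}^{\alpha,\bullet}$ to $K$, extended by $0$ to $\Omega$. Multiscale functions. For $1\le i\le N$, $\phi_i^\varepsilon|_K=\phi_i|_K+\phi_i|_K(x_{c,K})\chi_K^{0,\bullet}+\sum_{\alpha=1}^d\partial_\alpha(\phi_i|_K)\chi_K^{\alpha,\bullet}$ for all $K\in\mathcal T_H$. $V_{H,0}^\varepsilon=\mathrm{span}\{\phi_i^\varepsilon:1\le i\le N_0\}$. On $K$, set $W_K^0=1+\chi_K^{0,\bullet}$ and $W_K^\alpha=x^\alpha-x^\alpha_{c,K}+\chi_K^{\alpha,\bullet}$ for $1\le\alpha\le d$. *)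

(* Defs.v *)
From HB Require Import structures.
From mathcomp Require Import all_boot all_order all_algebra.
From mathcomp Require Import all_classical all_reals all_analysis.
Set Implicit Arguments. Unset Strict Implicit. Unset Printing Implicit Defensive.
Import Order.TTheory GRing.Theory Num.Theory.
Import numFieldNormedType.Exports.
Local Open Scope classical_set_scope.
Local Open Scope ring_scope.

(* Lebesgue measure on R^n = 'rV[R]_n: the sigma-algebra is the one generated
   by the coordinates (the Borel one), and the measure is obtained by taking
   iterated products of the one-dimensional Lebesgue measure. *)
Definition rV_display : measure_display -> measure_display.
Proof. exact. Qed.

Section rV_measurable.
Context {R : realType} {n : nat}.
Let coor (i : 'I_n) (x : 'rV[R]_n) : measurableTypeR R := x 0 i.

Let rV0 : g_sigma_preimage coor set0.
Proof. exact: sigma_algebra0. Qed.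
Let rVC A : g_sigma_preimage coor A -> g_sigma_preimage coor (~` A).
Proof. exact: sigma_algebraC. Qed.
Let rVU (F : _^nat) : (forall i, g_sigma_preimage coor (F i)) ->
  g_sigma_preimage coor (\bigcup_i (F i)).
Proof. exact: sigma_algebra_bigcup. Qed.

HB.instance Definition _ := @isMeasurable.Build (rV_display default_measure_display)
  'rV[R]_n (g_sigma_preimage coor) rV0 rVC rVU.

Lemma measurable_coor i : measurable_fun [set: 'rV[R]_n] (coor i).
Proof.
move=> _ Y mY; rewrite setTI; apply: sub_sigma_algebra => /=.
by rewrite -bigcup_seq/=; exists i => /=; [rewrite mem_index_enum|exists Y => //; rewrite setTI].
Qed.
End rV_measurable.

Section leb.
Context {R : realType}.
Definition consv n (p : measurableTypeR R * 'rV[R]_n) : 'rV[R]_n.+1 :=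
  \row_i oapp (p.2 ord0) p.1 (unlift ord0 i).

Lemma measurable_consv n : measurable_fun setT (@consv n).
Proof.
move=> _ /= Y; rewrite setTI.
pose F := image_set_system setT (@consv n) measurable.
have FE A : F A = measurable (@consv n @^-1` A) by rewrite /F /image_set_system /= setTI.
rewrite -FE; apply: smallest_sub.
  exact/sigma_algebra_image/sigma_algebra_measurable.
move=> A; rewrite -bigcup_seq => -[i _ [B mB <-]]; rewrite FE setTI.
rewrite [X in measurable X](_ : _ =
   (fun p : measurableTypeR R * 'rV[R]_n => (consv p) 0 i : measurableTypeR R) @^-1` B) //.
rewrite -[X in measurable X]setTI.
have : measurable_fun setT (fun p : measurableTypeR R * 'rV[R]_n => (consv p) 0 i : measurableTypeR R).
  case: (unliftP ord0 i) => [j ->|->].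
    rewrite (_ : (fun _ => _) = (fun x : 'rV[R]_n => x 0 j : measurableTypeR R) \o snd).
      by apply: measurableT_comp => //; exact: measurable_coor.
    by apply/funext => p /=; rewrite mxE liftK.
  rewrite (_ : (fun _ => _) = fst) //.
  by apply/funext => p /=; rewrite mxE unlift_none.
by apply.
Qed.

Definition leb_succ n (mu : {sigma_finite_measure set 'rV[R]_n -> \bar R}) :=
  pushforward ((@lebesgue_measure R) \x mu)%E (@consv n).

Section inst.
Variables (n : nat) (mu : {sigma_finite_measure set 'rV[R]_n -> \bar R}).
Let m0 : leb_succ mu set0 = 0%E.
Proof. by rewrite /leb_succ /pushforward preimage_set0 measure0. Qed.
Let mge0 A : (0 <= leb_succ mu A)%E.
Proof. by rewrite /leb_succ /pushforward; exact: measure_ge0. Qed.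
Let madd : semi_sigma_additive (leb_succ mu).
Proof.
have mc A : measurable A -> measurable (@consv n @^-1` A).
  by move=> mA; rewrite -[X in measurable X]setTI; exact: measurable_consv.
move=> F mF tF mUF; rewrite /leb_succ /pushforward preimage_bigcup.
apply: measure_semi_sigma_additive.
- by move=> k; exact: mc.
- apply/trivIsetP => /= i j _ _ ij; rewrite -preimage_setI.
  by move/trivIsetP : tF => /(_ _ _ _ _ ij) ->//; rewrite preimage_set0.
- by rewrite -preimage_bigcup; exact: mc.
Qed.
HB.instance Definition _ := isMeasure.Build _ _ _ (leb_succ mu) m0 mge0 madd.

Let msf : sigma_finite setT (leb_succ mu).
Proof.
have [F [FT Fm]] : exists F : (set (measurableTypeR R * 'rV[R]_n))^nat,
    setT = \bigcup_k F k /\ forall k, measurable (F k) /\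
      (((@lebesgue_measure R) \x mu) (F k) < +oo)%E.
  have /sigma_finiteP[F [TF ndF Foo]] := sigma_finiteT (@lebesgue_measure R).
  have /sigma_finiteP[G [TG ndG Goo]] := sigma_finiteT mu.
  exists (fun k => F k `*` G k); split.
    rewrite -setXTT TF TG predeqE => -[x y]; split.
      move=> [/= [k _ Fkx] [l _ Gly]]; exists (maxn k l) => //; split.
      - by move: x Fkx; exact/subsetPset/ndF/leq_maxl.
      - by move: y Gly; exact/subsetPset/ndG/leq_maxr.
    by move=> [k _ []/= ? ?]; split; exists k.
  move=> k; have [? ?] := Foo k; have [? ?] := Goo k.
  split; first exact: measurableX.
  by rewrite product_measure1E// lte_mul_pinfty// ge0_fin_numE.
exists (fun k => [set x : 'rV[R]_n.+1 | F k (x 0 0, \row_i x 0 (lift ord0 i))]).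
  rewrite predeqE => x; split => // _.
  have : [set: measurableTypeR R * 'rV[R]_n] (x 0 0, \row_i x 0 (lift ord0 i)) by [].
  by rewrite FT => -[k _ Fk]; exists k.
move=> k; have [mF fF] := Fm k; split.
- rewrite [X in measurable X](_ : _ =
    (fun x : 'rV[R]_n.+1 => (x 0 0 : measurableTypeR R, \row_i x 0 (lift ord0 i))) @^-1` F k)//.
  rewrite -[X in measurable X]setTI; suff : measurable_fun setT
    (fun x : 'rV[R]_n.+1 => (x 0 0 : measurableTypeR R, \row_i x 0 (lift ord0 i))) by apply.
  apply: measurable_fun_pair; first exact: measurable_coor.
  move=> _ Y; rewrite setTI.
  pose g (x : 'rV[R]_n.+1) : 'rV[R]_n := \row_i x 0 (lift ord0 i).
  pose G := image_set_system setT g measurable.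
  have GE A : G A = measurable (g @^-1` A) by rewrite /G /image_set_system /= setTI.
  rewrite -GE; apply: smallest_sub.
    exact/sigma_algebra_image/sigma_algebra_measurable.
  move=> A; rewrite -bigcup_seq => -[i _ [B mB <-]]; rewrite GE setTI.
  rewrite [X in measurable X](_ : _ =
    (fun x : 'rV[R]_n.+1 => x 0 (lift ord0 i) : measurableTypeR R) @^-1` B); last first.
    by apply/funext => x; rewrite /preimage /= /g mxE.
  by rewrite -[X in measurable X]setTI; exact: measurable_coor.
- rewrite /leb_succ /pushforward [X in product_measure1 _ _ X](_ : _ = F k)//.
  apply/funext => -[a v]; rewrite /preimage /= mxE unlift_none /=.
  by congr (F k (_, _)); apply/rowP => i; rewrite !mxE liftK.
Qed.
HB.instance Definition _ := Measure_isSigmaFinite.Build _ _ _ (leb_succ mu) msf.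
End inst.

(* For n = 0 this is the unit mass on the one-point space. *)
Fixpoint leb n : {sigma_finite_measure set 'rV[R]_n -> \bar R} :=
  match n return {sigma_finite_measure set 'rV[R]_n -> \bar R} with
  | 0 => [the {sigma_finite_measure set _ -> \bar R} of \d_ (0 : 'rV[R]_0)]
  | n'.+1 => [the {sigma_finite_measure set _ -> \bar R} of leb_succ (leb n')]
  end.
End leb.

(* Functions on R^d are plain functions 'rV[R]_d -> R; elements of L^2(U),
   H^1(U) are such functions, seen up to equality almost everywhere on U, and
   only their values on the open set U matter. *)
Section Sobolev.
Context {R : realType} {d : nat}.
Local Notation Rd := 'rV[R]_d.
Implicit Types (U S : set Rd) (u v f : Rd -> R) (g : 'I_d -> Rd -> R).

Definition dotv (x y : Rd) : R := \sum_i x 0 i * y 0 i.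

Definition L2 U u : Prop :=
  measurable_fun U u /\ (\int[leb d]_(x in U) ((u x) ^+ 2)%:E < +oo)%E.

Definition L2sq U u : R := \int[leb d]_(x in U) (u x) ^+ 2.

Fixpoint Ck (k : nat) f : Prop :=
  continuous f /\
  if k is k'.+1 then
    forall i : 'I_d, (forall x, derivable f x 'e_i) /\
                     Ck k' (fun x => 'D_('e_i) f x)
  else True.

Definition smooth f : Prop := forall k, Ck k f.

Definition test_function U f : Prop :=
  [/\ smooth f, compact (closure [set x | f x != 0])
    & closure [set x | f x != 0] `<=` U].

Definition weak_gradient U u g : Prop :=
  forall (i : 'I_d) f, test_function U f ->
    \int[leb d]_(x in U) (u x * 'D_('e_i) f x) =
    - \int[leb d]_(x in U) (g i x * f x).

(* u is in H^1(U) with (weak) gradient g *)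
Definition H1grad U u g : Prop :=
  [/\ L2 U u, forall i, L2 U (g i) & weak_gradient U u g].

Definition H1 U u : Prop := exists g, H1grad U u g.

Definition H1normsq U u g : R := L2sq U u + \sum_i L2sq U (g i).

Definition H1_cvg U (un : nat -> Rd -> R) u : Prop :=
  exists (gn : nat -> 'I_d -> Rd -> R) g,
    [/\ forall n, H1grad U (un n) (gn n), H1grad U u g
      & (fun n => H1normsq U (fun x => un n x - u x)
                             (fun i x => gn n i x - g i x)) @ \oo --> 0].

Definition H10 U u : Prop :=
  exists un, (forall n, test_function U (un n)) /\ H1_cvg U un u.

Definition linear_on (P : (Rd -> R) -> Prop) (l : (Rd -> R) -> R) : Prop :=
  forall (c : R) u v, P u -> P v ->
    l (fun x => c * u x + v x) = c * l u + l v.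

Definition bilinear_on (P : (Rd -> R) -> Prop)
    (b : (Rd -> R) -> (Rd -> R) -> R) : Prop :=
  (forall w, P w -> linear_on P (b w)) /\
  (forall w, P w -> linear_on P (fun u => b u w)).

Definition H1_dual U (l : (Rd -> R) -> R) : Prop :=
  linear_on (H1 U) l /\
  exists C : R, forall u g, H1grad U u g ->
    `|l u| <= C * Num.sqrt (H1normsq U u g).

(* The bound makes the form independent of the representatives. *)
Definition H1_bilinear_form U (b : (Rd -> R) -> (Rd -> R) -> R) : Prop :=
  bilinear_on (H1 U) b /\
  exists C : R, forall u gu v gv, H1grad U u gu -> H1grad U v gv ->
    `|b u v| <= C * Num.sqrt (H1normsq U u gu) * Num.sqrt (H1normsq U v gv).

Definition affine_fun f : Prop :=
  exists (a : R) (b : Rd), forall x, f x = a + dotv b x.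

End Sobolev.

Section Polytopes.
Context {R : realType} {d : nat}.
Local Notation Rd := 'rV[R]_d.
Implicit Types (S F : set Rd).

Definition hull (I : finType) (A : {set I}) (p : I -> Rd) : set Rd :=
  [set x | exists c : I -> R, [/\ forall i, 0 <= c i,
     \sum_(i in A) c i = 1 & x = \sum_(i in A) c i *: p i]].

(* Closed bounded polytopal domain, not necessarily convex: a finite union of
   convex hulls of finite point sets without lower-dimensional parts. *)
Definition polytope S : Prop :=
  [/\ S !=set0, S = closure (interior S)
    & exists (I : finType) (p : I -> Rd) (C : seq {set I}),
        S = [set x | exists2 A, A \in C & hull A p x]].

Definition bdry S : set Rd := closure S `\` interior S.

(* x is a vertex of S when S is not invariant, near x, under translations in
   some direction e; for a convex polytope this means extreme point. *)
Definition is_vertex S (x : Rd) : Prop :=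
  S x /\ ~ exists (e : Rd) (r : R), [/\ e != 0, 0 < r &
     forall y t, ball x r y -> ball x r (y + t *: e) -> (S y <-> S (y + t *: e))].

(* near x, S is the half-space {y | n . (y - x) <= 0} *)
Definition flat_at S (n x : Rd) : Prop :=
  exists2 r : R, 0 < r & forall y, ball x r y -> (S y <-> dotv n (y - x) <= 0).

(* (d-1)-dimensional face of S: closure of a connected component of the set of
   flat boundary points lying in one hyperplane *)
Definition is_face S F : Prop :=
  exists n x0 : Rd, [/\ n != 0, flat_at S n x0 &
    F = closure (connected_component
          [set y | flat_at S n y /\ dotv n (y - x0) = 0] x0)].

(* Affine isometries t |-> p + t J from R^(d-1) onto a hyperplane containing F *)
Definition hyperplane_frame F (pJ : Rd * 'M[R]_(d.-1, d)) : Prop :=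
  pJ.2 *m pJ.2^T = 1%:M /\ F `<=` [set pJ.1 + t *m pJ.2 | t in [set: 'rV[R]_d.-1]].

(* Surface integral over a subset F of a hyperplane; by isometry invariance of
   the Lebesgue measure it does not depend on the frame picked by xget. *)
Definition surface_integral F (g : Rd -> R) : R :=
  let pJ := xget (0, 0) (hyperplane_frame F) in
  \int[leb d.-1]_(t in [set t | F (pJ.1 + t *m pJ.2)]) g (pJ.1 + t *m pJ.2).

Definition face_average F (g : Rd -> R) : R :=
  surface_integral F g / surface_integral F (fun=> 1).

End Polytopes.

Variant method := MsFEM_lin | MsFEM_CR.
Variant corrector_kind := DOF_extended | DOF_continuous.

Section DOF.
Context {R : realType} {d : nat}.
Local Notation Rd := 'rV[R]_d.

(* What a degree of freedom is attached to: a vertex, or a face. *)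
Definition site (m : method) : Type :=
  match m with MsFEM_lin => Rd | MsFEM_CR => set Rd end.

(* DOF of a function defined pointwise (used for affine functions) *)
Definition dof (m : method) : site m -> (Rd -> R) -> R :=
  match m with
  | MsFEM_lin => fun x g => g x
  | MsFEM_CR => fun F g => face_average F g
  end.

(* "The DOF of u in H^1(S) at the site z exists and equals c".
   CR: c is the average over the face of the trace of u, the trace being
   defined by density of smooth functions.
   lin: c is the value at the point x of a function w, continuous at x within
   S, that equals u in H^1(S) or, when x is a boundary point, has the same
   trace as u on the boundary (the point value is then that of the trace). *)
Definition has_dof (m : method) (S : set Rd) : site m -> (Rd -> R) -> R -> Prop :=
  match m with
  | MsFEM_lin => fun x u c =>
      exists w : Rd -> R,
        [/\ H1 (interior S) w, w @ within S (nbhs x) --> w x, w x = c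
          & u = w %[ae leb d in interior S] \/
            (bdry S x /\ H10 (interior S) (fun y => u y - w y))]
  | MsFEM_CR => fun F u c =>
      exists un : nat -> Rd -> R,
        [/\ forall n, smooth (un n), H1_cvg (interior S) un u
          & (fun n => face_average F (un n)) @ \oo --> c]
  end.

(* Gamma(S, u) = gam, for the operator Gamma with sites z *)
Definition Gamma (m : method) (S : set Rd) (z : 'I_d.+1 -> site m)
    (u : Rd -> R) (gam : 'rV[R]_d.+1) : Prop :=
  forall i, has_dof S (z i) u (gam 0 i).

Definition Gamma_well_defined (m : method) (S : set Rd) (z : 'I_d.+1 -> site m)
    (V : (Rd -> R) -> Prop) : Prop :=
  forall v, V v -> exists! gam, Gamma S z v gam.

Definition Gamma_bijective_P1 (m : method) (z : 'I_d.+1 -> site m) : Prop :=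
  forall gam : 'rV[R]_d.+1,
    exists! l : Rd -> R, affine_fun l /\ forall i, dof (z i) l = gam 0 i.

End DOF.

(* A simplicial mesh: vertices, and cells given by their d+1 vertices. *)
Record mesh (R : realType) (d : nat) := Mesh {
  nvtx : nat;
  vtx : 'I_nvtx -> 'rV[R]_d;
  ncell : nat;
  cell : 'I_ncell -> 'I_d.+1 -> 'I_nvtx
}.

Section Mesh.
Context {R : realType} {d : nat} (T : mesh R d).
Local Notation Rd := 'rV[R]_d.
Implicit Types (K : 'I_(ncell T)) (v : Rd -> R).

Definition cell_vertices K : {set 'I_(nvtx T)} := [set cell K i | i : 'I_d.+1].

Definition simplex K : set Rd := hull (cell_vertices K) (@vtx _ _ T).

Definition icell K : set Rd := interior (simplex K).

Definition vol K : R := fine (leb d (simplex K)).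

Definition centroid K : Rd := (d.+1%:R)^-1 *: \sum_(i < d.+1) vtx (cell K i).

(* the face opposite to the i-th vertex *)
Definition face K (i : 'I_d.+1) : set Rd :=
  hull (cell_vertices K :\ cell K i) (@vtx _ _ T).

Definition nondegenerate K : Prop :=
  \matrix_(i < d) (vtx (cell K (lift ord0 i)) - vtx (cell K ord0)) \in unitmx.

Definition conformal_mesh (Omega : set Rd) : Prop :=
  [/\ injective (@vtx _ _ T) /\ (forall p, exists K i, cell K i = p),
      forall K, nondegenerate K,
      injective cell_vertices,
      (forall K K', simplex K `&` simplex K' =
         hull (cell_vertices K :&: cell_vertices K') (@vtx _ _ T))
    & Omega = \bigcup_K simplex K].

(* H^1(T_H) *)
Definition brokenH1 (Omega : set Rd) v : Prop :=
  L2 Omega v /\ forall K, H1 (icell K) v.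

(* P_1(T_H): the values on the mesh skeleton (a null set) are irrelevant. *)
Definition P1 v : Prop :=
  forall K, exists2 l, affine_fun l & forall x, icell K x -> v x = l x.

(* for v in P_1(T_H), the affine function that coincides with v on K *)
Definition P1_on K v : Rd -> R := fun y =>
  v (centroid K) +
  \sum_(i < d) 'D_('e_i) v (centroid K) * (y - centroid K) 0 i.

Definition eq_cells (u v : Rd -> R) : Prop :=
  forall K x, icell K x -> u x = v x.

(* V_H; interior faces are those shared by two cells *)
Definition VH (m : method) (Omega : set Rd) v : Prop :=
  P1 v /\
  match m with
  | MsFEM_lin => {within Omega, continuous v}
  | MsFEM_CR => forall K K' i i', K != K' -> face K i = face K' i' ->
      surface_integral (face K i) (fun x => P1_on K v x - P1_on K' v x) = 0
  end.

(* sites of Gamma(K, .) *)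
Definition cell_site (m : method) K : 'I_d.+1 -> @site R d m :=
  match m return 'I_d.+1 -> site m with
  | MsFEM_lin => fun i => vtx (cell K i)
  | MsFEM_CR => fun i => face K i
  end.

Definition boundary_site (m : method) (Omega : set Rd) : @site R d m -> Prop :=
  match m return site m -> Prop with
  | MsFEM_lin => fun x => bdry Omega x
  | MsFEM_CR => fun F => F `<=` bdry Omega
  end.

Definition VH0 (m : method) (Omega : set Rd) v : Prop :=
  VH m Omega v /\
  forall K i, boundary_site Omega (cell_site m K i) ->
    dof (cell_site m K i) (P1_on K v) = 0.

Definition basis_of (n : nat) (phi : 'I_n -> Rd -> R)
    (W : (Rd -> R) -> Prop) : Prop :=
  (forall i, W (phi i)) /\
  forall v, W v ->
    exists! c : 'rV[R]_n, eq_cells v (fun x => \sum_i c 0 i * phi i x).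

(* z enumerates the vertices (lin) or faces (CR) of the mesh, the N0 ones that
   are not on the boundary coming first. *)
Definition numbering (m : method) (Omega : set Rd) (N0 N1 : nat)
    (z : 'I_(N0 + N1) -> @site R d m) : Prop :=
  [/\ injective z, forall j, exists K i, z j = cell_site m K i,
      forall K i, exists j, z j = cell_site m K i
    & forall j : 'I_(N0 + N1), boundary_site Omega (z j) <-> (N0 <= j)%N].

Definition dual_basis (m : method) (Omega : set Rd) (N0 N1 : nat)
    (z : 'I_(N0 + N1) -> @site R d m) (phi : 'I_(N0 + N1) -> Rd -> R) : Prop :=
  [/\ basis_of phi (VH m Omega),
      (forall j k K i, cell_site m K i = z k ->
         dof (z k) (P1_on K (phi j)) = (j == k)%:R)
    & basis_of (fun i : 'I_N0 => phi (lshift N1 i)) (VH0 m Omega)].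

(* S'_K: image of K under the homothety of ratio rho centred at its centroid *)
Definition dilated_cell K (rho : R) : set Rd :=
  [set centroid K + rho *: (x - centroid K) | x in simplex K].

Definition oversampling_patch (Omega : set Rd) K (rho : R) : set Rd :=
  dilated_cell K rho `&` Omega.

(* A face of S_K collapses to a single vertex if its trace on the shrunk
   homothetic cells is a single point for some ratio between rho and 1.  In
   dimension one faces are points and do not collapse. *)
Definition additional_face K (rho : R) (F : set Rd) : Prop :=
  ~ (exists x, F = [set x]) /\
  exists rho' x, 1 <= rho' <= rho /\ F `&` dilated_cell K rho' = [set x].

Definition dilated_face (Omega : set Rd) K (rho : R) (F : set Rd) : Prop :=
  is_face (oversampling_patch Omega K rho) F /\ ~ additional_face K rho F.

(* z is an admissible choice of sites for Gamma(S_K, .): d+1 distinct vertices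
   of S_K (lin), or all the dilated faces, assumed to be d+1 in number (CR) *)
Definition patch_sites (m : method) (Omega : set Rd) K (rho : R) :
    ('I_d.+1 -> @site R d m) -> Prop :=
  match m return ('I_d.+1 -> site m) -> Prop with
  | MsFEM_lin => fun z => injective z /\
      forall i, is_vertex (oversampling_patch Omega K rho) (z i)
  | MsFEM_CR => fun z => injective z /\
      forall F, dilated_face Omega K rho F <-> exists i, z i = F
  end.

End Mesh.

Section Sampling.
Context {R : realType} {d : nat} (m : method).
Local Notation Rd := 'rV[R]_d.
(* oversampling patch, sites of Gamma(S, .), sampling space and form *)
Variables (S : set Rd) (z : 'I_d.+1 -> @site R d m).
Variables (V : (Rd -> R) -> Prop) (s : (Rd -> R) -> (Rd -> R) -> R).

(* V_{K,0} *)
Definition V0 (w : Rd -> R) : Prop := V w /\ Gamma S z w 0.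

Definition sampling_solution (g : (Rd -> R) -> R) (v : Rd -> R) : Prop :=
  V v /\ forall w, V0 w -> s v w = g w.

(* Well-posedness, the constraint being on the values of Gamma(S', .) with
   sites z' (S' = S_K, or S' = K in the DOF-continuous case); uniqueness is in
   H^1(S), i.e. almost everywhere. *)
Definition well_posed (S' : set Rd) (z' : 'I_d.+1 -> @site R d m) : Prop :=
  forall g gam, H1_dual (interior S) g ->
    (exists v, sampling_solution g v /\ Gamma S' z' v gam) /\
    (forall v v', sampling_solution g v -> Gamma S' z' v gam ->
       sampling_solution g v' -> Gamma S' z' v' gam ->
       v = v' %[ae leb d in interior S]).

(* V is a subspace of H^1(S) and s a bilinear form on it, both compatible with
   equality almost everywhere on S. *)
Definition sampling_space : Prop :=
  [/\ forall u, V u -> H1 (interior S) u,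
      forall (c : R) u v, V u -> V v -> V (fun x => c * u x + v x),
      forall u v, V u -> H1 (interior S) v ->
        u = v %[ae leb d in interior S] -> V v
    & forall l, affine_fun l -> V l].

Definition sampling_form : Prop :=
  bilinear_on V s /\
  forall u u' v v', V u -> V u' -> V v -> V v' ->
    u = u' %[ae leb d in interior S] -> v = v' %[ae leb d in interior S] ->
    s u v = s u' v'.

Definition sampling_problem : Prop :=
  [/\ sampling_space, sampling_form, Gamma_bijective_P1 z,
      Gamma_well_defined S z V & well_posed S z].

(* additional assumption for DOF-continuous correctors; K is the cell and zK
   the sites of Gamma(K, .) *)
Definition continuity_problem (K : set Rd) (zK : 'I_d.+1 -> @site R d m) : Prop :=
  Gamma_well_defined K zK V /\ well_posed K zK.

(* chi solves the corrector equation for the affine function l *)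
Definition is_corrector (b : corrector_kind) (K : set Rd)
    (zK : 'I_d.+1 -> @site R d m) (l chi : Rd -> R) : Prop :=
  sampling_solution (fun w => - s l w) chi /\
  match b with
  | DOF_extended => Gamma S z chi 0
  | DOF_continuous => Gamma K zK chi 0
  end.

End Sampling.

Section MsFEM.
Context {R : realType} {d : nat} (T : mesh R d) (Omega : set 'rV[R]_d).
Local Notation Rd := 'rV[R]_d.
Implicit Types (K : 'I_(ncell T)) (u v : Rd -> R).

Variable a : 'I_(ncell T) -> (Rd -> R) -> (Rd -> R) -> R.
(* chi0 K = chi_{S_K}^0 and chi K i = chi_{S_K}^i, functions on S_K *)
Variables (chi0 : 'I_(ncell T) -> Rd -> R)
          (chi : 'I_(ncell T) -> 'I_d -> Rd -> R).

(* x^i - x_{c,K}^i *)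
Definition centred_coord K (i : 'I_d) : Rd -> R := fun x => (x - centroid K) 0 i.

(* restriction of chi_{S_K} to K, extended by 0 *)
Definition chi0_cell K : Rd -> R := chi0 K \_ (simplex K).
Definition chi_cell K (i : 'I_d) : Rd -> R := chi K i \_ (simplex K).

Definition W0 K : Rd -> R := fun x => 1 + chi0_cell K x.
Definition W K (i : 'I_d) : Rd -> R := fun x => centred_coord K i x + chi_cell K i x.

Definition multiscale_functions (N : nat) (phi phieps : 'I_N -> Rd -> R) : Prop :=
  forall i K x, icell K x ->
    phieps i x = phi i x + phi i (centroid K) * chi0_cell K x
      + \sum_(al < d) 'D_('e_al) (phi i) (centroid K) * chi_cell K al x.

Definition Mbar K : R := (vol K)^-1 * a K (W0 K) (fun=> 1).
Definition B1bar K : Rd := \row_al ((vol K)^-1 * a K (W K al) (fun=> 1)).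
Definition B2bar K : Rd := \row_be ((vol K)^-1 * a K (W0 K) (centred_coord K be)).
Definition Abar K : 'M[R]_d :=
  \matrix_(be, al) ((vol K)^-1 * a K (W K al) (centred_coord K be)).

Definition grad u (x : Rd) : Rd := \row_i 'D_('e_i) u x.

Definition abar_integrand K u v : Rd -> R := fun x =>
  dotv (grad v x) (grad u x *m (Abar K)^T)
  + v x * dotv (B1bar K) (grad u x)
  + u x * dotv (B2bar K) (grad v x)
  + Mbar K * u x * v x.

Definition centroid_quadrature K (g : Rd -> R) : R := vol K * g (centroid K).

(* int_K of the integrand replaced by the one-point centroid rule; 'D is a
   classical derivative, the arguments being affine near the centroid. *)
Definition abar_quad K u v : R := centroid_quadrature K (abar_integrand K u v).

Definition load (f v : Rd -> R) : R := \int[leb d]_(x in Omega) (f x * v x).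

(* span of the phieps i in H^1(T_H), whose elements are compared a.e. on the
   cells *)
Definition Veps (N : nat) (phieps : 'I_N -> Rd -> R) u : Prop :=
  brokenH1 T Omega u /\
  exists c : 'I_N -> R, forall K,
    u = (fun x => \sum_i c i * phieps i x) %[ae leb d in icell K].

Definition PG_MsFEM_solution (m : method) (f : Rd -> R)
    (N : nat) (phieps : 'I_N -> Rd -> R) u : Prop :=
  Veps phieps u /\
  forall v, VH0 T m Omega v -> \sum_K a K u v = load f v.

Definition effective_solution (m : method) (f u : Rd -> R) : Prop :=
  VH0 T m Omega u /\
  forall v, VH0 T m Omega v -> \sum_K abar_quad K u v = load f v.

Definition post_processed (uH ueps : Rd -> R) : Prop :=
  brokenH1 T Omega ueps /\
  forall K, ueps = (fun x => uH (centroid K) * W0 K x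
      + \sum_(al < d) 'D_('e_al) uH (centroid K) * W K al x)
    %[ae leb d in icell K].

Definition A_eps (N : nat) (phi phieps : 'I_N -> Rd -> R) : 'M[R]_N :=
  \matrix_(j, i) \sum_K a K (phieps i) (phi j).

Definition A_P1 (N : nat) (phi : 'I_N -> Rd -> R) : 'M[R]_N :=
  \matrix_(j, i) \sum_K abar_quad K (phi i) (phi j).

(* a = sum_K a_K is coercive on H^1_0(Omega) *)
Definition coercive_H10 : Prop :=
  exists2 c : R, 0 < c & forall u g,
    H10 (interior Omega) u -> H1grad (interior Omega) u g ->
    c * H1normsq (interior Omega) u g <= \sum_K a K u u.

Definition coercive_cell K : Prop :=
  exists2 alpha : R, 0 < alpha & forall u g, H1grad (icell K) u g ->
    alpha * \sum_i L2sq (icell K) (g i) <= a K u u.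

End MsFEM.

(* Main.v *)
Require Import Defs.
From HB Require Import structures.
From mathcomp Require Import all_boot all_order all_algebra.
From mathcomp Require Import all_classical all_reals all_analysis measurable_realfun.
From mathcomp Require Import ring lra.
Set Implicit Arguments. Unset Strict Implicit. Unset Printing Implicit Defensive.
Import Order.TTheory GRing.Theory Num.Theory.
Import numFieldNormedType.Exports.
Local Open Scope classical_set_scope.
Local Open Scope ring_scope.

(** A function of P_1 is determined on a cell K by its value and its gradient at
    the centroid, so phi_j is on K a combination of 1 and of the centred
    coordinates.  Expanding phi_i in the same way, phi_i^eps is on K the
    combination of W_K^0 and of the W_K^alpha with those same coefficients for
    phi_i: it is the post-processing of phi_i (lemma post_process_correction).
    Hence a_K(phi_i^eps, phi_j) is a combination of the (d+1)^2 values of a_K on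
    these functions, which are |K| times the effective coefficients, and the
    weights are the products of centroid values and gradients that the one-point
    rule evaluates (lemmas abar_quadE, form_post_process).  This gives the
    equality of the matrices.  Post-processing is linear and maps phi_i to
    phi_i^eps, so it maps V_{H,0} onto V_{H,0}^eps (lemma post_process_sum), and
    the two problems have the same equations.

    The analytic content lies in the conditions under which these expansions are
    legitimate.
    - The centroid is interior to K and |K| is a positive finite number
      (centroid_interior, vol_neq0), so that derivatives at the centroid are the
      coefficients of the affine function and 1/|K| is an inverse.
    - Affine functions and the W belong to H^1(K), where a_K is bilinear: they
      are restrictions of elements of the sampling space V_K, contained in
      H^1(S_K), and K lies in S_K (simplex_sub_patch, H1_sub).
    - a_K only sees almost everywhere classes on K (H1_form_ae_eq), which
      allows replacing functions by the above expansions.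
    - V_{H,0} is closed under combinations (VH0_comb); for the Crouzeix-Raviart
      space this is the linearity of surface integrals on affine functions over
      a face (surface_integral_comb). *)

(** * Borel sets and Lebesgue measure on row vectors *)

Section rV_borel.
Context {R : realType} {n : nat}.
Implicit Types (x : 'rV[R]_n) (U : set 'rV[R]_n).

Lemma ball_measurable_rV x (r : R) : measurable (ball x r).
Proof.
have [r0|r0] := leP r 0.
  rewrite (_ : ball x r = set0) //.
  by apply/seteqP; split => // y [] /=; rewrite ltNge r0.
rewrite (_ : ball x r = \bigcap_(i in [set: 'I_n])
   ((fun y : 'rV[R]_n => y 0 i : measurableTypeR R) @^-1` ball (x 0 i) r)).
  apply: fin_bigcap_measurable; first exact: finite_finset.
  move=> i _; rewrite -[X in measurable X]setTI.
  apply: measurable_coor => //; rewrite ball_itv; exact: measurable_itv.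
apply/seteqP; split => y.
  by move=> [_ xy] i _; exact: xy.
by move=> xy; split => // j i; rewrite ord1; exact: xy.
Qed.

(** Every open set is the union of the balls of rational centre and radius
    1/k that it contains, hence belongs to the sigma-algebra generated by the
    coordinates. *)
Lemma open_measurable_rV U : open U -> measurable U.
Proof.
move=> oU.
pose B (p : 'rV[rat]_n * nat) : set 'rV[R]_n :=
  ball (\row_i ratr (p.1 0 i) : 'rV[R]_n) p.2.+1%:R^-1.
rewrite (_ : U = \bigcup_p (if `[< B p `<=` U >] then B p else set0)).
  apply: countable_bigcupT_measurable; first exact: countableP.
  by move=> p; case: ifP => // _; exact: ball_measurable_rV.
apply/seteqP; split => x; last first.
  by move=> [p _]; case: asboolP => // pU /pU.
move=> Ux; have /nbhs_ballP[e /= e0 xeU] : nbhs x U by exact: open_nbhs_nbhs.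
have [k ke] : exists k : nat, k.+1%:R^-1 < e / 2.
  have [k _ /(_ _ (leqnn k))] :=
    near_infty_natSinv_lt (PosNum (divr_gt0 e0 (ltr0Sn R 1))).
  by exists k.
have k0 : 0 < k.+1%:R^-1 :> R by rewrite invr_gt0.
have /choice[q hq] : forall i : 'I_n, exists q : rat, ball (x 0 i) k.+1%:R^-1 (ratr q).
  move=> i; have [|q] := @rat_in_itvoo R (x 0 i) (x 0 i + k.+1%:R^-1).
    by rewrite ltrDl.
  rewrite in_itv /= => /andP[q1 q2]; exists q.
  rewrite /ball /= ltr_norml ltrBDl ltrBlDr.
  move: q1 q2 k0; set a := _^-1; set c := ratr q => *.
  by apply/andP; split; lra.
have xB : B (\row_i q i, k) x.
  by split => //= i j; rewrite ord1 !mxE /=; exact/ball_sym/hq.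
exists (\row_i q i, k) => //; case: asboolP => // -[].
move=> y By; apply: xeU; apply: (@le_ball _ _ _ (k.+1%:R^-1 + k.+1%:R^-1)).
  by rewrite (splitr e) lerD// ltW.
exact: ball_triangle (ball_sym xB) By.
Qed.

Lemma closed_measurable_rV (C : set 'rV[R]_n) : closed C -> measurable C.
Proof.
move=> cC; rewrite -(setCK C); apply: measurableC; apply: open_measurable_rV.
exact: closed_openC.
Qed.

Lemma continuous_measurable_rV (f : 'rV[R]_n -> R) :
  continuous f -> measurable_fun setT f.
Proof.
move=> /continuousP cf; apply: (measurability _ (RGenOpens.measurableE R)).
move=> _ [_ [a [b ->] <-]]; rewrite setTI; apply: open_measurable_rV.
exact/cf/interval_open.
Qed.

End rV_borel.

(** Balls are cubes for the sup norm, so their measure is a product of lengths. *)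
Lemma leb_ball {R : realType} n (x : 'rV[R]_n) (r : R) : 0 < r ->
  leb n (ball x r) = ((r *+ 2) ^+ n)%:E.
Proof.
move=> r0; elim: n x => [|n IH] x.
  rewrite expr0 /= diracE mem_set //.
  by split => // i [].
rewrite (_ : leb n.+1 (ball x r) = leb_succ (leb n) (ball x r)) //.
rewrite /leb_succ /pushforward.
rewrite (_ : _ @^-1` _ = ball (x 0 0) r `*` ball (\row_i x 0 (lift ord0 i)) r).
  rewrite product_measure1E; last 2 first.
  - by rewrite ball_itv; exact: measurable_itv.
  - exact: ball_measurable_rV.
  by rewrite IH exprS EFinM; congr (_ * _)%E; exact: lebesgue_measure_ball (ltW r0).
apply/seteqP; split => -[a v] /=.
  move=> [_ xv]; split => /=.
    by have := xv 0 0; rewrite mxE unlift_none.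
  by split => // i j; have := xv 0 (lift ord0 j); rewrite !mxE liftK !ord1.
move=> [/= xa [_ xv]]; split => // i j; rewrite ord1 mxE.
case: (unliftP ord0 j) => [k ->|->] //=.
by have := xv 0 k; rewrite !mxE.
Qed.

Lemma leb_compact_fin {R : realType} n (C : set 'rV[R]_n) : compact C ->
  (leb n C < +oo)%E.
Proof.
move=> cC; have mC : measurable C.
  by apply: closed_measurable_rV; apply: compact_closed cC; exact: norm_hausdorff.
have [M [_ CM]] := compact_bounded cC.
pose r := `|M| + 2.
have r0 : 0 < r by rewrite ltr_wpDl.
apply: (@le_lt_trans _ _ (leb n (ball 0 r))); last by rewrite leb_ball// ltry.
apply: le_measure; rewrite ?inE//; first exact: ball_measurable_rV.
move=> x /(CM (`|M| + 1)) xM; rewrite -ball_normE /= sub0r normrN.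
apply: le_lt_trans (xM _) _; last by rewrite ltrD2l ltr1n.
by rewrite ltr_pwDr// ler_norm.
Qed.

Lemma continuous_compact_integrable_rV {R : realType} n (C : set 'rV[R]_n) f :
  compact C -> continuous f -> (leb n).-integrable C (EFin \o f).
Proof.
move=> cC cf; apply: measurable_bounded_integrable.
- by apply: closed_measurable_rV; apply: compact_closed cC; exact: norm_hausdorff.
- exact: leb_compact_fin.
- by apply: measurable_funS (continuous_measurable_rV cf).
- have /compact_bounded : compact (f @` C).
    by apply: continuous_compact => //; exact: continuous_subspaceT.
  move=> [M [Mr h]]; exists M; split => // y My x Cx.
  by apply: (h y My); exists x.
Qed.

(** * Affine functions *)

Lemma continuous_bigsum {R : realType} (T : topologicalType)
    (V : normedModType R) (I : Type) (r : seq I) (P : pred I)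
    (f : I -> T -> V) :
  (forall i, continuous (f i)) -> continuous (fun x => \sum_(i <- r | P i) f i x).
Proof.
move=> cf; elim: r => [|i r IH] x.
  by under eq_fun do rewrite big_nil; exact: cvg_cst.
under eq_fun do rewrite big_cons.
by case: ifP => _; [apply: cvgD; [exact: cf|exact: IH]|exact: IH].
Qed.

Section affine.
Context {R : realType} {d : nat}.
Implicit Types (x y b : 'rV[R]_d) (l : 'rV[R]_d -> R).

Lemma dotvD b x y : dotv b (x + y) = dotv b x + dotv b y.
Proof. by rewrite -big_split; apply: eq_bigr => i _; rewrite mxE mulrDr. Qed.

Lemma dotvZ b c x : dotv b (c *: x) = c * dotv b x.
Proof. by rewrite mulr_sumr; apply: eq_bigr => i _; rewrite mxE mulrCA. Qed.

Lemma dotv_delta b i : dotv b 'e_i = b 0 i.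
Proof.
rewrite /dotv (bigD1 i) //= mxE !eqxx mulr1 big1 ?addr0 // => j ji.
by rewrite mxE (negPf ji) andbF mulr0.
Qed.

Lemma continuous_dotv b : continuous (dotv b).
Proof.
apply: (@continuous_bigsum R _ R) => i x.
apply: (@cvgMl_tmp _ _ (nbhs x)); exact: (@coord_continuous _ _ _ 0 i).
Qed.

Lemma affine_continuous l : affine_fun l -> continuous l.
Proof.
move=> [a [b /funext ->]] x.
apply: (@cvgD _ _ _ (nbhs x) _ (fun=> a) (dotv b)); first exact: cvg_cst.
exact: continuous_dotv.
Qed.

Lemma affine_cst a : affine_fun (fun _ : 'rV[R]_d => a).
Proof.
by exists a, 0 => x; rewrite /dotv big1 ?addr0// => i _; rewrite mxE mul0r.
Qed.

Lemma affine_comb c l1 l2 : affine_fun l1 -> affine_fun l2 ->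
  affine_fun (fun x => c * l1 x + l2 x).
Proof.
move=> [a [b l1E]] [a' [b' l2E]]; exists (c * a + a'), (c *: b + b') => x.
rewrite l1E l2E [dotv (c *: b + b') x](_ : _ = c * dotv b x + dotv b' x); first ring.
rewrite mulr_sumr -big_split; apply: eq_bigr => i _ /=.
by rewrite !mxE; ring.
Qed.

Lemma affine_coord y i : affine_fun (fun x : 'rV[R]_d => (x - y) 0 i).
Proof.
exists (- y 0 i), 'e_i => x; rewrite !mxE addrC; congr (_ + _).
rewrite /dotv (bigD1 i) //= mxE !eqxx mul1r big1 ?addr0 // => j ji.
by rewrite mxE (negPf ji) andbF mul0r.
Qed.

Lemma affine_sum (I : finType) (c : I -> R) (l : I -> 'rV[R]_d -> R) :
  (forall i, affine_fun (l i)) -> affine_fun (fun x => \sum_i c i * l i x).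
Proof.
move=> al; elim: (index_enum I) => [|i r IH].
  by under eq_fun do rewrite big_nil; exact: affine_cst.
by under eq_fun do rewrite big_cons; exact: affine_comb.
Qed.

(** The difference quotients of l in the direction e_i are constant. *)
Lemma near_affine_is_derive l u x a b i :
  (forall y, l y = a + dotv b y) -> (\near x, u x = l x) ->
  is_derive x 'e_i u (b 0 i).
Proof.
move=> lE ul; apply: (@near_eq_is_derive _ _ _ l).
  by near=> y; apply/esym; near: y.
have h : forall h : R, h != 0 -> h^-1 *: (l (h *: 'e_i + x) - l x) = b 0 i.
  move=> h h0; rewrite !lE dotvD dotvZ dotv_delta.
  rewrite (_ : _ - _ = h * b 0 i); last ring.
  by rewrite /GRing.scale /= mulKf.
have cv : h^-1 *: ((l \o shift x) (h *: 'e_i) - l x) @[h --> 0^'] --> b 0 i.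
  apply: cvg_near_cst; near=> t; apply: h; near: t.
  exact: nbhs_dnbhs_neq.
split; first by apply/cvg_ex; exists (b 0 i); exact: cv.
by apply: cvg_lim cv; exact: Rhausdorff.
Unshelve. all: by end_near.
Qed.

Lemma near_affine_derive l u x a b i :
  (forall y, l y = a + dotv b y) -> (\near x, u x = l x) ->
  'D_('e_i) u x = b 0 i.
Proof. by move=> lE ul; have [] := near_affine_is_derive i lE ul. Qed.

End affine.

(** * Convex hulls and simplicial cells *)

Section hull.
Context {R : realType} {d : nat} {I : finType}.
Implicit Types (A : {set I}) (p : I -> 'rV[R]_d).

(** The hull is the image of the compact set of weights in the unit cube that sum
    to 1. *)
Lemma hull_compact A p : compact (hull A p).
Proof.
pose s (v : 'rV[R]_#|I|) := \sum_(i in A) v 0 (enum_rank i).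
pose g (v : 'rV[R]_#|I|) := \sum_(i in A) v 0 (enum_rank i) *: p i.
pose C := [set v : 'rV[R]_#|I| | forall k, v ord0 k \in `[0, 1]].
have cs : continuous s.
  by apply: (@continuous_bigsum R _ R) => i; exact: coord_continuous.
have cg : continuous g.
  apply: (@continuous_bigsum R) => i v.
  have ci := @coord_continuous R 1 _ 0 (enum_rank i) v.
  exact: cvgZr_tmp ci.
have cC : compact C.
  by have := @rV_compact R #|I| (fun=> `[0 : R, 1]%classic)
    (fun=> @segment_compact R 0 1).
have -> : hull A p = g @` (C `&` s @^-1` [set 1]).
  apply/seteqP; split => [x [c [c0 c1 ->]]|_ [v [Cv sv] <-]].
    (* the weights outside A are unconstrained in the hull: set them to 0 *)
    exists (\row_k (if enum_val k \in A then c (enum_val k) else 0)); last first.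
      by apply: eq_bigr => i iA; rewrite mxE enum_rankK iA.
    split; last first.
      by rewrite /= -c1; apply: eq_bigr => i iA; rewrite mxE enum_rankK iA.
    move=> k; rewrite mxE in_itv /=; case: ifPn => kA; rewrite ?lexx ?ler01// c0 /=.
    by rewrite -c1 (bigD1 (enum_val k)) //= lerDl sumr_ge0.
  exists (fun i => v 0 (enum_rank i)); split => //.
  by move=> i; have := Cv (enum_rank i); rewrite in_itv /= => /andP[].
apply: continuous_compact; first exact: continuous_subspaceT.
apply: (subclosed_compact _ cC (@subIsetl _ _ _)).
apply: closedI; first by apply: compact_closed => //; exact: norm_hausdorff.
apply: preimage_closed; first by move=> v _; exact: cs.
exact: closed_eq.
Qed.

Lemma hull_convex A p x y (t : R) : 0 <= t <= 1 -> hull A p x -> hull A p y ->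
  hull A p (t *: x + (1 - t) *: y).
Proof.
move=> /andP[t0 t1] [c [c0 c1 ->]] [c' [c'0 c'1 ->]].
exists (fun i => t * c i + (1 - t) * c' i); split.
- by move=> i; rewrite addr_ge0// mulr_ge0// subr_ge0.
- by rewrite big_split /= -!mulr_sumr c1 c'1; ring.
- rewrite !scaler_sumr -big_split /=; apply: eq_bigr => i _.
  by rewrite [RHS]scalerDl !scalerA.
Qed.
End hull.

Section cells.
Context {R : realType} {d : nat} (T : mesh R d).
Implicit Types K : 'I_(ncell T).

Lemma icell_open K : open (icell K). Proof. exact: open_interior. Qed.

(** Weights indexed by the local vertex numbers; those of equal vertices add up. *)
Lemma hull_vertices K (c : 'I_d.+1 -> R) : (forall i, 0 <= c i) ->
  \sum_i c i = 1 -> simplex K (\sum_i c i *: vtx (cell K i)).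
Proof.
move=> c0 c1; exists (fun p => \sum_(i | cell K i == p) c i); split.
- by move=> p; rewrite sumr_ge0.
- rewrite -c1 (partition_big (cell K) (mem (cell_vertices K))) //=.
  by move=> i _; apply/imsetP; exists i.
- rewrite (partition_big (cell K) (mem (cell_vertices K))) /=; last first.
    by move=> i _; apply/imsetP; exists i.
  apply: eq_bigr => p _; rewrite scaler_suml; apply: eq_bigr => i /eqP <-.
  by [].
Qed.

(** The barycentric coordinates are affine functions of the point, all equal to
    1/(d+1) > 0 at the centroid; they stay positive nearby, where the point is
    thus a convex combination of the vertices. *)
Lemma centroid_interior K : Defs.nondegenerate K -> icell K (centroid K).
Proof.
move=> nd; set v0 := vtx (cell K ord0).
pose M : 'M[R]_d := \matrix_(i < d) (vtx (cell K (lift ord0 i)) - v0).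
have uM : M \in unitmx := nd.
pose mu x : 'rV[R]_d := (x - v0) *m invmx M.
have cmu i : continuous (fun x => mu x 0 i).
  rewrite (_ : (fun _ => _) = fun x => \sum_j invmx M j i * (x - v0) 0 j).
    by apply: affine_continuous; apply: affine_sum => j; exact: affine_coord.
  by apply/funext => x; rewrite mxE; apply: eq_bigr => j _; rewrite mulrC.
have csmu : continuous (fun x => \sum_i mu x 0 i).
  exact: (@continuous_bigsum R _ R).
have muc : mu (centroid K) = const_mx (d.+1%:R^-1).
  rewrite /mu -[RHS](mulmxK uM); congr (_ *m _).
  apply/rowP => j; rewrite !mxE summxE big_ord_recl /=.
  under [RHS]eq_bigr do rewrite !mxE.
  rewrite -mulr_sumr sumrB sumr_const card_ord -/v0.
  set y := v0 0 j; set s := \sum_(i < d) _.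
  have n0 : d.+1%:R != 0 :> R by rewrite pnatr_eq0.
  rewrite -[y *+ d]mulr_natr.
  by rewrite -natr1 in n0 *; field.
have pos : \forall x \near centroid K,
    (forall i, 0 < mu x 0 i) /\ \sum_i mu x 0 i < 1.
  near=> x; split.
    near: x; apply: filter_forall => i.
    apply: (cvgr_gt _ (cmu i _)); rewrite muc mxE invr_gt0 //.
  near: x; apply: (cvgr_lt _ (csmu _)); rewrite muc.
  under eq_bigr do rewrite mxE.
  by rewrite sumr_const card_ord -[X in X < _]mulr_natl ltr_pdivrMr// mul1r ltr_nat.
rewrite /icell /interior /=; near=> x.
have [] : (forall i, 0 < mu x 0 i) /\ \sum_i mu x 0 i < 1 by near: x; exact: pos.
move=> mu0 mu1.
pose c (i : 'I_d.+1) := if unlift ord0 i is Some j then mu x 0 j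
                        else 1 - \sum_j mu x 0 j.
have c0 : c ord0 = 1 - \sum_j mu x 0 j by rewrite /c unlift_none.
have cS j : c (lift ord0 j) = mu x 0 j by rewrite /c liftK.
have -> : x = \sum_i c i *: vtx (cell K i).
  rewrite big_ord_recl; under eq_bigr do rewrite cS; rewrite c0 -/v0.
  have /eqP : x - v0 = \sum_i mu x 0 i *: vtx (cell K (lift ord0 i))
                  - (\sum_i mu x 0 i) *: v0.
    rewrite -[LHS](mulmxKV uM) mulmx_sum_row scaler_suml -sumrB.
    by apply: eq_bigr => i _; rewrite rowK scalerBr.
  rewrite subr_eq => /eqP xE.
  by rewrite {1}xE scalerBl scale1r -addrA addrC (addrC _ v0).
apply: hull_vertices.
  move=> i; rewrite /c; case: unliftP => [j _|_]; first exact: ltW.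
  by rewrite subr_ge0 ltW.
by rewrite big_ord_recl; under eq_bigr do rewrite cS; rewrite c0 subrK.
Unshelve. all: by end_near.
Qed.

(** The simplex contains a ball around its centroid, and is compact. *)
Lemma vol_neq0 K : Defs.nondegenerate K -> vol K != 0.
Proof.
move=> nd; have /nbhs_ballP[e /= e0 eK] : nbhs (centroid K) (simplex K).
  exact: centroid_interior.
have cK : compact (simplex K) by exact: hull_compact.
rewrite /vol gt_eqF// fine_gt0// leb_compact_fin// andbT.
apply: (@lt_le_trans _ _ (leb d (ball (centroid K) e))).
  by rewrite leb_ball// lte_fin exprn_gt0// pmulrn_lgt0.
apply: le_measure; rewrite ?inE//; first exact: ball_measurable_rV.
by apply: closed_measurable_rV; apply: compact_closed cK; exact: norm_hausdorff.
Qed.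

(** K is star-shaped with respect to its centroid: shrinking a point of K
    by 1/rho towards the centroid gives the antecedent under the homothety. *)
Lemma simplex_sub_patch (Omega : set 'rV[R]_d) K (rho : R) :
  Defs.nondegenerate K -> simplex K `<=` Omega -> 1 <= rho ->
  icell K `<=` interior (oversampling_patch Omega K rho).
Proof.
move=> nd KO rho1; apply: interiorS => x Kx; split; last exact: KO.
have r0 : 0 < rho by apply: lt_le_trans rho1.
exists (rho^-1 *: x + (1 - rho^-1) *: centroid K).
  apply: hull_convex => //; last by apply: interior_subset; exact: centroid_interior.
  by rewrite invr_ge0 ltW//= invf_le1.
move: (centroid K) => c; apply/rowP => j; rewrite !mxE; field.
by rewrite gt_eqF.
Qed.

End cells.

(** * Restriction and almost everywhere equality in H^1 *)

Section sobolev.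
Context {R : realType} {d : nat}.
Local Notation Rd := 'rV[R]_d.
Implicit Types (U : set Rd) (u v w f : Rd -> R).

Lemma L2_eq_on U u v : (forall x, U x -> u x = v x) -> L2 U u -> L2 U v.
Proof.
move=> uv [mu ou]; split.
  by apply: eq_measurable_fun mu => x /set_mem; exact: uv.
move: ou; congr (_ < _)%E; apply: eq_integral => x /set_mem /uv.
by move=> ->.
Qed.

Lemma H1_eq_on U u v : (forall x, U x -> u x = v x) -> H1 U u -> H1 U v.
Proof.
move=> uv [g [u2 g2 ug]]; exists g; split => //; first exact: L2_eq_on uv u2.
move=> i f Uf; rewrite -ug //; apply: eq_Rintegral => x /set_mem /uv.
by move=> ->.
Qed.

Lemma L2_sub U U' u : measurable U -> measurable U' -> U `<=` U' ->
  L2 U' u -> L2 U u.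
Proof.
move=> mU mU' UU' [mu ou]; split; first exact: measurable_funS mu.
apply: le_lt_trans ou; apply: ge0_subset_integral => //.
  by apply/measurable_EFinP; exact: measurable_funX.
by move=> x _; rewrite lee_fin sqr_ge0.
Qed.

(** Near a point outside U a test function vanishes, the support being closed. *)
Lemma test_function_out U f : test_function U f ->
  forall x, ~ U x -> f x = 0 /\ forall i, 'D_('e_i) f x = 0.
Proof.
move=> [_ _ fU] x Ux; set S := closure _ in fU *.
have Sx : ~ S x by move/fU.
have f0 y : ~ S y -> f y = 0.
  move=> Sy; apply: contrapT => fy; apply: Sy; apply: subset_closure.
  exact/eqP.
split => [|i]; first exact: f0.
have [] // := @near_affine_is_derive R d (cst 0) f x 0 0 i; last first.
- by move=> _ ->; rewrite mxE.
- have : open (~` S) by apply: closed_openC; exact: closed_closure.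
  by rewrite openE => /(_ _ Sx); apply: filterS => y; exact: f0.
- by move=> y; rewrite /dotv big1 ?addr0 // => j _; rewrite mxE mul0r.
Qed.

Lemma test_function_derive_measurable U f i : test_function U f ->
  measurable_fun setT (fun x => 'D_('e_i) f x).
Proof.
move=> [/(_ 1%N) [_ /(_ i) [_ [cf _]]] _ _].
exact: continuous_measurable_rV.
Qed.

(** A test function on U is a test function on any larger open set, and its
    integrals do not see the points outside U. *)
Lemma H1_sub U U' u : open U -> open U' -> U `<=` U' -> H1 U' u -> H1 U u.
Proof.
move=> oU oU' UU' [g [u2 g2 ug]].
have mU : measurable U by exact: open_measurable_rV.
have mU' : measurable U' by exact: open_measurable_rV.
have UE (w h : Rd -> R) : (forall x, ~ U x -> h x = 0) ->
    \int[leb d]_(x in U) (w x * h x) = \int[leb d]_(x in U') (w x * h x).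
  move=> h0; rewrite Rintegral_mkcond [RHS]Rintegral_mkcond.
  congr (Rintegral _ _ _); apply/funext => x; rewrite /patch.
  have [xU|xU] := boolP (x \in U).
    by rewrite mem_set //; apply: UU'; exact/set_mem.
  rewrite h0 ?mulr0 ?if_same // => Ux; by rewrite mem_set in xU.
exists g; split; [exact: L2_sub u2|by move=> i; exact: L2_sub (g2 i)|].
move=> i f Uf; have f0 := test_function_out Uf.
rewrite !UE; last 2 first.
- by move=> x /f0[].
- by move=> x /f0[].
apply: ug; case: Uf => sf cf fU; split => //.
exact: subset_trans fU UU'.
Qed.

Lemma Rintegral_ae0 U w v : measurable U ->
  measurable_fun U w -> measurable_fun U v ->
  w = (fun=> 0) %[ae leb d in U] -> \int[leb d]_(x in U) (w x * v x) = 0.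
Proof.
move=> mU mw mv w0; rewrite /Rintegral (@ae_eq_integral _ _ _ _ _ (cst 0)%E) //.
- by rewrite integral0.
- by apply/measurable_EFinP; exact: measurable_funM.
- apply: filterS w0 => x w0 Ux /=.
  by rewrite w0 ?mul0r.
Qed.

(** The partial derivatives of test functions are measurable, so that replacing w
    by 0 does not change the integrals defining the weak gradient. *)
Lemma H1grad_ae0 U w : open U -> measurable_fun U w ->
  w = (fun=> 0) %[ae leb d in U] ->
  H1grad U w (fun _ _ => 0) /\ H1normsq U w (fun _ _ => 0) = 0.
Proof.
move=> oU mw w0; have mU : measurable U by exact: open_measurable_rV.
have L20 : L2 U (fun=> 0).
  split; first exact: measurable_cst.
  by under eq_integral do rewrite expr0n; rewrite integral0.
split; last first.
  rewrite /H1normsq /L2sq big1 ?addr0.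
    by under eq_Rintegral do rewrite expr2; exact: Rintegral_ae0.
  by move=> i _; rewrite expr0n /Rintegral integral0.
split => //.
- split => //; rewrite (@ae_eq_integral _ _ _ _ _ (cst 0)%E) //.
  + by rewrite integral0.
  + by apply/measurable_EFinP; exact: measurable_funX.
  + apply: filterS w0 => x w0 Ux /=.
    by rewrite w0 // expr0n.
- move=> i f Uf; rewrite Rintegral_ae0 //; last first.
    by apply: measurable_funS (test_function_derive_measurable i Uf).
  under eq_Rintegral do rewrite mul0r.
  by rewrite /Rintegral integral0 oppr0.
Qed.

(** The difference w of u and u' has 0 as a weak gradient, hence norm 0,
    and the bound of the form makes b vanish on w. *)
Lemma H1_form_ae_eq U b u u' v : open U -> H1_bilinear_form U b ->
  H1 U u -> H1 U u' -> H1 U v -> u = u' %[ae leb d in U] ->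
  b u v = b u' v /\ b v u = b v u'.
Proof.
move=> oU [[bl br] [C hC]] hu hu' hv uu'.
have mU : measurable U by exact: open_measurable_rV.
pose w x := -1 * u x + u' x.
have [wg w0] : H1grad U w (fun _ _ => 0) /\ H1normsq U w (fun _ _ => 0) = 0.
  apply: H1grad_ae0 => //.
    case: hu hu' => g [[mu _] _ _] [g' [[mu' _] _ _]].
    by apply: measurable_funD => //; apply: measurable_funM.
  apply: filterS uu' => x h Ux; rewrite /w h //; ring.
have [g vg] := hv.
have := hC _ _ _ _ wg vg; have := hC _ _ _ _ vg wg.
rewrite w0 sqrtr0 !(mulr0, mul0r) !normr_le0.
rewrite (bl _ hv) // (br _ hv) // => /eqP vw /eqP wv.
by split; lra.
Qed.

End sobolev.

(** * Surface integrals of affine functions *)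

Section surface.
Context {R : realType}.

Lemma continuous_mulmxr m n (p : 'rV[R]_n) (J : 'M[R]_(m, n)) :
  continuous (fun t : 'rV[R]_m => p + t *m J).
Proof.
have cs : continuous (fun t : 'rV[R]_m => \sum_i t 0 i *: row i J).
  apply: (@continuous_bigsum R) => i t.
  have ci := @coord_continuous R 1 m 0 i t.
  exact: cvgZr_tmp ci.
move=> t; rewrite /continuous_at.
under eq_fun do rewrite mulmx_sum_row.
rewrite mulmx_sum_row.
apply: (@cvgD _ _ _ (nbhs t) _ (fun=> p)); [exact: cvg_cst|exact: cs].
Qed.

Lemma affine_mulmxr m n (p : 'rV[R]_n) (J : 'M[R]_(m, n)) l : affine_fun l ->
  continuous (fun t : 'rV[R]_m => l (p + t *m J)).
Proof.
move=> /affine_continuous cl t.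
exact: (continuous_comp (@continuous_mulmxr _ _ p J t) (cl _)).
Qed.

(** If F has a frame (p, J), then J J^T = 1 makes t the image of p + t J under a
    continuous map, so the parameters of the points of F form a compact set, on
    which affine functions are integrable.  If F lies in no hyperplane, the
    default frame (0, 0) makes the integrands constant. *)
Lemma surface_integral_comb d (F : set 'rV[R]_d) c l1 l2 : compact F ->
  affine_fun l1 -> affine_fun l2 ->
  surface_integral F (fun x => c * l1 x + l2 x) =
  c * surface_integral F l1 + surface_integral F l2.
Proof.
move=> cF al1 al2; rewrite /surface_integral.
case: xgetP => [[p J] _ [/= JJ _]|_] /=; last first.
  under eq_Rintegral do rewrite mulmx0 addr0.
  under [X in _ = _ * X + _]eq_Rintegral do rewrite mulmx0 addr0.
  under [X in _ = _ + X]eq_Rintegral do rewrite mulmx0 addr0.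
  have mF : measurable [set t : 'rV[R]_d.-1 | F (0 + t *m 0)].
    have [F0|F0] := pselect (F 0).
      rewrite (_ : [set _ | _] = setT) //; apply/seteqP; split => // t _ /=.
      by rewrite mulmx0 addr0.
    rewrite (_ : [set _ | _] = set0) //; apply/seteqP; split => // t /=.
    by rewrite mulmx0 addr0.
  by rewrite !Rintegral_cst //; ring.
set D := [set t | _].
have clF : closed F by apply: compact_closed cF; exact: norm_hausdorff.
have cD : compact D.
  apply: (@subclosed_compact _ _ ((fun x => - (p *m J^T) + x *m J^T) @` F)).
  - by apply: preimage_closed => // t _; exact: continuous_mulmxr.
  - apply: continuous_compact => //; apply: continuous_subspaceT.
    exact: continuous_mulmxr.
  - move=> t Dt; exists (p + t *m J) => //.
    by rewrite mulmxDl -mulmxA JJ mulmx1 addKr.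
have mD : measurable D.
  by apply: closed_measurable_rV; apply: compact_closed cD; exact: norm_hausdorff.
have int l : affine_fun l ->
    (leb d.-1).-integrable D (EFin \o (fun t => l (p + t *m J))).
  by move=> al; apply: continuous_compact_integrable_rV => //; exact: affine_mulmxr.
rewrite RintegralD //; last exact: int.
  by rewrite RintegralZl //; exact: int.
by apply: (int (fun x => c * l1 x)); have := affine_comb c al1 (affine_cst 0);
  under eq_fun do rewrite addr0.
Qed.

Lemma face_average_comb d (F : set 'rV[R]_d) c l1 l2 : compact F ->
  affine_fun l1 -> affine_fun l2 ->
  face_average F (fun x => c * l1 x + l2 x) =
  c * face_average F l1 + face_average F l2.
Proof.
by move=> cF al1 al2; rewrite /face_average surface_integral_comb//; ring.
Qed.
End surface.

(** * P_1 functions and the space V_{H,0} *)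

Section P1_functions.
Context {R : realType} {d : nat} (T : mesh R d).
Hypothesis nd : forall K : 'I_(ncell T), Defs.nondegenerate K.
Implicit Types (K : 'I_(ncell T)) (u v l : 'rV[R]_d -> R).

Lemma icell_near K (P : 'rV[R]_d -> Prop) :
  (forall x, icell K x -> P x) -> \forall x \near centroid K, P x.
Proof.
move=> h; have /filterS : nbhs (centroid K) (icell K).
  by apply: nbhs_interior; exact: centroid_interior.
exact.
Qed.

Lemma P1_on_eq K v l : affine_fun l -> (forall x, icell K x -> v x = l x) ->
  P1_on K v = l.
Proof.
move=> [a [b lE]] vl; apply/funext => y; rewrite /P1_on.
rewrite vl; last exact: centroid_interior.
under eq_bigr do rewrite (near_affine_derive _ lE (icell_near vl)).
rewrite !lE -addrA; congr (_ + _).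
by rewrite -/(dotv b (y - centroid K)) -dotvD addrC subrK.
Qed.

Lemma P1_onE K v x : P1 T v -> icell K x -> v x = P1_on K v x.
Proof. by move=> /(_ K)[l al vl] Kx; rewrite (P1_on_eq al vl) vl. Qed.

Lemma affine_P1_on K v : affine_fun (P1_on K v).
Proof.
have := affine_comb (v (centroid K)) (@affine_cst R d 1)
  (affine_sum (fun i => 'D_('e_i) v (centroid K))
     (fun i => affine_coord (centroid K) i)).
by congr affine_fun; apply/funext => y; rewrite mulr1.
Qed.

Lemma P1_comb c u v : P1 T u -> P1 T v -> P1 T (fun x => c * u x + v x).
Proof.
move=> hu hv K; have [l al ul] := hu K; have [l' al' vl'] := hv K.
exists (fun x => c * l x + l' x); first exact: affine_comb.
by move=> x Kx; rewrite ul ?vl'.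
Qed.

Lemma P1_on_comb K c u v : P1 T u -> P1 T v ->
  P1_on K (fun x => c * u x + v x) = (fun x => c * P1_on K u x + P1_on K v x).
Proof.
move=> hu hv; apply: P1_on_eq; first by apply: affine_comb; exact: affine_P1_on.
by move=> x Kx; rewrite -!P1_onE.
Qed.

Lemma P1_on0 K : P1_on K (fun=> 0) = (fun=> 0).
Proof. by apply: P1_on_eq => //; exact: affine_cst. Qed.

Lemma derive_centred_affine K i v a (b : 'I_d -> R) :
  (forall x, icell K x -> v x = a + \sum_j b j * (x - centroid K) 0 j) ->
  'D_('e_i) v (centroid K) = b i.
Proof.
move=> vE.
rewrite (@near_affine_derive R d (fun x => (a - dotv (\row_j b j) (centroid K))
  + dotv (\row_j b j) x) v _ _ _ i (fun=> erefl)); first by rewrite mxE.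
apply: icell_near => x /vE ->.
rewrite -addrA [- _ + _]addrC; congr (_ + _).
rewrite -sumrB; apply: eq_bigr => j _.
by rewrite !mxE mulrBr.
Qed.

Section VH0.
Variables (m : method) (Omega : set 'rV[R]_d).

Lemma face_compact K i : compact (face K i).
Proof. exact: hull_compact. Qed.

Lemma dof_comb K i c l1 l2 : affine_fun l1 -> affine_fun l2 ->
  dof (cell_site m K i) (fun x => c * l1 x + l2 x) =
  c * dof (cell_site m K i) l1 + dof (cell_site m K i) l2.
Proof.
case: m => //= al1 al2; exact: (face_average_comb _ (@face_compact K i)).
Qed.

(** Degrees of freedom and jumps are linear in the affine parts of the function. *)
Lemma VH0_comb c u v : VH0 T m Omega u -> VH0 T m Omega v ->
  VH0 T m Omega (fun x => c * u x + v x).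
Proof.
move=> [[Pu cu] bu] [[Pv cv] bv]; split; last first.
  move=> K i bd; rewrite P1_on_comb // dof_comb; try exact: affine_P1_on.
  by rewrite bu // bv // mulr0 addr0.
split; first exact: P1_comb.
case: m cu cv {bu bv} => cu cv.
  move=> x; apply: cvgD; last exact: cv.
  by apply: cvgMl_tmp; exact: cu.
move=> K K' i i' KK' ff.
pose j w x := -1 * P1_on K' w x + P1_on K w x.
have aj w : affine_fun (j w) by apply: affine_comb; exact: affine_P1_on.
have jE w : (fun x => P1_on K w x - P1_on K' w x) = j w.
  by apply/funext => x; rewrite /j mulN1r addrC.
rewrite !P1_on_comb // (_ : (fun _ => _) = fun x => c * j u x + j v x); last first.
  by apply/funext => x; rewrite /j; ring.
rewrite surface_integral_comb //; last exact: face_compact.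
by rewrite -!jE (cu _ _ _ _ KK' ff) (cv _ _ _ _ KK' ff) mulr0 addr0.
Qed.

Lemma VH0_0 : VH0 T m Omega (fun=> 0).
Proof.
have s0 (F : set 'rV[R]_d) : surface_integral F (fun=> 0) = 0.
  by rewrite /surface_integral /Rintegral integral0.
split; last first.
  move=> K i _; rewrite P1_on0; case: m => //=.
  by rewrite /face_average s0 mul0r.
split; first by move=> K; exists (fun=> 0) => //; exact: affine_cst.
case: m => [|K K' i i' _ _]; first by move=> x; exact: cvg_cst.
by rewrite !P1_on0; under eq_fun do rewrite subr0.
Qed.

Lemma VH0_sum (I : finType) (c : I -> R) (phi : I -> 'rV[R]_d -> R) :
  (forall i, VH0 T m Omega (phi i)) ->
  VH0 T m Omega (fun x => \sum_i c i * phi i x).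
Proof.
move=> hphi; elim: (index_enum I) => [|i r IH].
  by under eq_fun do rewrite big_nil; exact: VH0_0.
by under eq_fun do rewrite big_cons; exact: VH0_comb.
Qed.
End VH0.

End P1_functions.

(** * The effective form on a cell *)

(** The partial sums stay in Q, a class closed under combinations inside the
    domain P on which l is linear. *)
Lemma linear_on_sum {R : realType} {d : nat} (P Q : ('rV[R]_d -> R) -> Prop) l
    (I : finType) (c : I -> R) (w : I -> 'rV[R]_d -> R) :
  linear_on P l -> (forall u, Q u -> P u) -> Q (fun=> 0) ->
  (forall c u v, Q u -> Q v -> Q (fun x => c * u x + v x)) ->
  (forall i, Q (w i)) ->
  Q (fun x => \sum_i c i * w i x) /\
  l (fun x => \sum_i c i * w i x) = \sum_i c i * l (w i).
Proof.
move=> lin QP Q0 Qc Qw; elim: (index_enum I) => [|i r [Qr lr]].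
  rewrite big_nil; under eq_fun do rewrite big_nil; split => //.
  have := lin (-1) _ _ (QP _ Q0) (QP _ Q0).
  by under eq_fun do rewrite mulr0 addr0; move=> ->; rewrite mulN1r addNr.
under eq_fun do rewrite big_cons.
by rewrite big_cons lin ?lr; [split => //; exact: Qc|exact: QP|exact: QP].
Qed.

Section effective_form.
Context {R : realType} {d : nat} (T : mesh R d).
Implicit Types (K : 'I_(ncell T)) (u v : 'rV[R]_d -> R).
Variables (a : 'I_(ncell T) -> ('rV[R]_d -> R) -> ('rV[R]_d -> R) -> R)
          (chi0 : 'I_(ncell T) -> 'rV[R]_d -> R)
          (chi : 'I_(ncell T) -> 'I_d -> 'rV[R]_d -> R).
Hypothesis nd : forall K, Defs.nondegenerate K.

Definition post_process K u : 'rV[R]_d -> R := fun x =>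
  u (centroid K) * W0 chi0 K x
  + \sum_(al < d) 'D_('e_al) u (centroid K) * W chi K al x.

(** The affine parts of the W reproduce u; the correctors remain. *)
Lemma post_process_correction K u x : P1 T u -> icell K x ->
  post_process K u x = u x + u (centroid K) * chi0_cell chi0 K x
    + \sum_(al < d) 'D_('e_al) u (centroid K) * chi_cell chi K al x.
Proof.
move=> Pu Kx; rewrite (P1_onE nd Pu Kx) /post_process /P1_on /W0 /W.
under eq_bigr do rewrite mulrDr.
by rewrite big_split /= /centred_coord; ring.
Qed.

(** On K, the value and the gradient of u at the centroid are the same
    combinations of those of the phi_i. *)
Lemma post_process_sum K (I : finType) (c : I -> R) (phi : I -> 'rV[R]_d -> R) u x :
  (forall i, P1 T (phi i)) -> eq_cells T u (fun y => \sum_i c i * phi i y) ->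
  post_process K u x = \sum_i c i * post_process K (phi i) x.
Proof.
move=> Pphi uE.
have uc := uE K _ (centroid_interior (nd K)).
have Du al : 'D_('e_al) u (centroid K) =
    \sum_i c i * 'D_('e_al) (phi i) (centroid K).
  apply: (@derive_centred_affine _ _ _ nd K al u (\sum_i c i * phi i (centroid K))
    (fun be => \sum_i c i * 'D_('e_be) (phi i) (centroid K))) => y Ky.
  rewrite (uE K) //.
  under eq_bigr do rewrite (P1_onE nd (Pphi _) Ky) /P1_on mulrDr.
  rewrite big_split /=; congr (_ + _).
  under eq_bigr do rewrite mulr_sumr.
  rewrite exchange_big; apply: eq_bigr => al' _.
  by rewrite mulr_suml; apply: eq_bigr => i _; rewrite mulrA.
rewrite /post_process uc mulr_suml.
under [X in _ + X]eq_bigr do rewrite Du mulr_suml.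
rewrite exchange_big -big_split; apply: eq_bigr => i _ /=.
rewrite [RHS]mulrDr mulrA; congr (_ + _).
by rewrite mulr_sumr; apply: eq_bigr => al _; rewrite mulrA.
Qed.

(** Q stands for a space of functions in which the affine functions and the W
    live; the sampling space provides it. *)
Section one_cell.
Variables (K : 'I_(ncell T)) (Q : ('rV[R]_d -> R) -> Prop).
Hypothesis Ka : H1_bilinear_form (icell K) (a K).
Hypothesis QH1 : forall u, Q u -> H1 (icell K) u.
Hypothesis Qcomb : forall c u v, Q u -> Q v -> Q (fun x => c * u x + v x).
Hypothesis Qaffine : forall l, affine_fun l -> Q l.
Hypothesis QW0 : Q (W0 chi0 K).
Hypothesis QW : forall al, Q (W chi K al).

Let Q0 : Q (fun=> 0). Proof. by apply: Qaffine; exact: affine_cst. Qed.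

Lemma form_split l c0 (c : 'I_d -> R) w0 (w : 'I_d -> 'rV[R]_d -> R) :
  linear_on (H1 (icell K)) l -> Q w0 -> (forall i, Q (w i)) ->
  Q (fun x => c0 * w0 x + \sum_i c i * w i x) /\
  l (fun x => c0 * w0 x + \sum_i c i * w i x) = c0 * l w0 + \sum_i c i * l (w i).
Proof.
move=> lin Qw0 Qw.
have [Qs ls] := linear_on_sum c lin QH1 Q0 Qcomb Qw.
by rewrite lin ?ls; [split => //; exact: Qcomb|exact: QH1|exact: QH1].
Qed.

Lemma post_process_H1 u : H1 (icell K) (post_process K u).
Proof.
have [[bl _] _] := Ka.
apply: QH1; have [] // := form_split (u (centroid K))
  (fun al => 'D_('e_al) u (centroid K)) (bl _ (QH1 Q0)) QW0 QW.
Qed.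

(** Both arguments of a_K are combinations of d+1 fixed functions, weighted by the
    values and gradients at the centroid that the quadrature reads; the effective
    coefficients are the values of a_K on these functions, divided by |K|. *)
Lemma abar_quadE u v :
  a K (post_process K u) (P1_on K v) = abar_quad a chi0 chi K u v.
Proof.
have [[bl br] _] := Ka.
have Qcoord i : Q (@centred_coord R d T K i).
  by apply: Qaffine; exact: affine_coord.
have Q1 : Q (fun=> 1) by apply: Qaffine; exact: affine_cst.
have vE w : Q w -> a K w (P1_on K v) = v (centroid K) * a K w (fun=> 1)
    + \sum_be 'D_('e_be) v (centroid K) * a K w (centred_coord K be).
  move=> Qw; rewrite -(form_split _ _ (bl _ (QH1 Qw)) Q1 Qcoord).2.
  by congr (a K w _); apply/funext => x; rewrite mulr1.
have QP1 : Q (P1_on K v) by apply: Qaffine; exact: affine_P1_on.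
rewrite (form_split _ _ (br _ (QH1 QP1)) QW0 QW).2.
under eq_bigr do rewrite vE //.
rewrite vE //.
have V0 : vol K != 0 by exact: vol_neq0.
rewrite /abar_quad /centroid_quadrature /abar_integrand.
set c := centroid K; rewrite !mulrDr.
(* the four terms of the integrand, with |K| simplified *)
rewrite [X in _ = X + _ + _ + _](_ : _ = \sum_al \sum_be 'D_('e_al) u c *
    ('D_('e_be) v c * a K (W chi K al) (centred_coord K be))); last first.
  rewrite /dotv mulr_sumr exchange_big; apply: eq_bigr => be _ /=.
  rewrite !mxE !mulr_sumr; apply: eq_bigr => al _; rewrite !mxE.
  by field.
rewrite [X in _ = _ + X + _ + _](_ : _ =
  \sum_al 'D_('e_al) u c * (v c * a K (W chi K al) (fun=> 1))); last first.
  rewrite /dotv !mulr_sumr; apply: eq_bigr => al _; rewrite !mxE; by field.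
rewrite [X in _ = _ + X + _](_ : _ =
  u c * \sum_be 'D_('e_be) v c * a K (W0 chi0 K) (centred_coord K be)); last first.
  rewrite /dotv !mulr_sumr; apply: eq_bigr => al _; rewrite !mxE; by field.
rewrite [X in _ = _ + X](_ : _ = u c * (v c * a K (W0 chi0 K) (fun=> 1))); last first.
  by rewrite /Mbar; field.
under eq_bigr do rewrite mulrDr mulr_sumr.
rewrite big_split /=; ring.
Qed.

Lemma form_post_process ueps u v : H1 (icell K) ueps -> P1 T v ->
  ueps = post_process K u %[ae leb d in icell K] ->
  a K ueps v = abar_quad a chi0 chi K u v.
Proof.
move=> hue Pv ue; rewrite -abar_quadE.
have hl : H1 (icell K) (P1_on K v) by apply: QH1; apply: Qaffine; exact: affine_P1_on.
have hv : H1 (icell K) v.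
  by apply: H1_eq_on hl => x Kx; rewrite (P1_onE nd Pv Kx).
have hp := post_process_H1 u.
rewrite (H1_form_ae_eq (@icell_open _ _ _ K) Ka hue hp hv ue).1.
apply: (H1_form_ae_eq (@icell_open _ _ _ K) Ka hv hl hp _).2.
by apply: aeW => x Kx; exact: P1_onE.
Qed.

End one_cell.
End effective_form.

(** * Equivalence with the effective problem *)

Theorem mainTheorem1
  (R : realType) (d : nat) (hd : (1 <= d)%N)
  (Omega : set 'rV[R]_d) (hOmega : polytope Omega)
  (T : mesh R d) (hT : conformal_mesh T Omega)
  (a : 'I_(ncell T) -> ('rV[R]_d -> R) -> ('rV[R]_d -> R) -> R)
  (ha : forall K, H1_bilinear_form (icell K) (a K))
  (ha_coercive : coercive_H10 Omega a)
  (ha_cell : forall K, coercive_cell a K)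
  (f : 'rV[R]_d -> R) (hf : L2 Omega f)
  (m : method) (N0 N1 : nat) (z : 'I_(N0 + N1) -> site m)
  (hz : numbering T Omega z)
  (phi : 'I_(N0 + N1) -> 'rV[R]_d -> R)
  (hphi : dual_basis T Omega z phi)
  (rho : 'I_(ncell T) -> R) (hrho : forall K, 1 <= rho K)
  (zS : 'I_(ncell T) -> 'I_d.+1 -> site m)
  (hzS : forall K, patch_sites Omega K (rho K) (zS K))
  (V : 'I_(ncell T) -> ('rV[R]_d -> R) -> Prop)
  (s : 'I_(ncell T) -> ('rV[R]_d -> R) -> ('rV[R]_d -> R) -> R)
  (hs : forall K,
     sampling_problem (oversampling_patch Omega K (rho K)) (zS K) (V K) (s K))
  (b : corrector_kind)
  (hb : b = DOF_continuous -> forall K,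
     continuity_problem (oversampling_patch Omega K (rho K)) (zS K) (V K) (s K)
       (simplex K) (cell_site m K))
  (chi0 : 'I_(ncell T) -> 'rV[R]_d -> R)
  (chi : 'I_(ncell T) -> 'I_d -> 'rV[R]_d -> R)
  (hchi0 : forall K,
     is_corrector (oversampling_patch Omega K (rho K)) (zS K) (V K) (s K)
       b (simplex K) (cell_site m K) (fun=> 1) (chi0 K))
  (hchi : forall K al,
     is_corrector (oversampling_patch Omega K (rho K)) (zS K) (V K) (s K)
       b (simplex K) (cell_site m K) (centred_coord K al) (chi K al))
  (phieps : 'I_(N0 + N1) -> 'rV[R]_d -> R)
  (hphieps : multiscale_functions chi0 chi phi phieps) :
  let phi_int := fun i : 'I_N0 => phi (lshift N1 i) in
  let phieps_int := fun i : 'I_N0 => phieps (lshift N1 i) in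
  A_eps a phi_int phieps_int = A_P1 a chi0 chi phi_int /\
  (forall ueps : 'rV[R]_d -> R,
     PG_MsFEM_solution Omega a m f phieps_int ueps <->
     exists uH : 'rV[R]_d -> R,
       effective_solution Omega a chi0 chi m f uH /\
       post_processed Omega chi0 chi uH ueps).
Proof.
move=> phi_int phieps_int.
have [_ nd _ _ OE] := hT.
have [[hphiVH _] _ [hphi0 hspan]] := hphi.
have KO (K : 'I_(ncell T)) : simplex K `<=` Omega by rewrite OE => x Kx; exists K.
have Pphi i : P1 T (phi i) by have [] := hphiVH i.
have PVH0 v : VH0 T m Omega v -> P1 T v by move=> [[]].
(* the restrictions to K of the elements of the sampling space *)
pose Q (K : 'I_(ncell T)) u := exists2 v, V K v & forall x, icell K x -> v x = u x.
have QH1 K u : Q K u -> H1 (icell K) u.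
  move=> [v Vv vu]; have [[VH1 _ _ _] _ _ _ _] := hs K.
  apply: H1_eq_on vu _; apply: H1_sub (VH1 _ Vv).
  - exact: icell_open.
  - exact: open_interior.
  - exact: simplex_sub_patch.
have Qcomb K c u v : Q K u -> Q K v -> Q K (fun x => c * u x + v x).
  move=> [u' Vu' u'u] [v' Vv' v'v]; have [[_ Vcomb _ _] _ _ _ _] := hs K.
  by exists (fun x => c * u' x + v' x); [exact: Vcomb|move=> x Kx; rewrite u'u ?v'v].
have Qaff K l : affine_fun l -> Q K l.
  move=> al; have [[_ _ _ Vaff] _ _ _ _] := hs K.
  by exists l => //; exact: Vaff.
have chiK (w : 'rV[R]_d -> R) (K : 'I_(ncell T)) x :
    icell K x -> (w \_ (simplex K)) x = w x.
  by move=> Kx; rewrite patchT //; apply/mem_set; exact: interior_subset.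
have QW0 K : Q K (W0 chi0 K).
  have [[Vchi _] _] := hchi0 K; have [[_ Vcomb _ Vaff] _ _ _ _] := hs K.
  exists (fun x => 1 * 1 + chi0 K x); last first.
    by move=> x Kx; rewrite /W0 /chi0_cell chiK // mulr1.
  by apply: (Vcomb 1 (fun=> 1)) => //; apply: Vaff; exact: affine_cst.
have QW K al : Q K (W chi K al).
  have [[Vchi _] _] := hchi K al; have [[_ Vcomb _ Vaff] _ _ _ _] := hs K.
  exists (fun x => 1 * centred_coord K al x + chi K al x); last first.
    by move=> x Kx; rewrite /W /chi_cell chiK // mul1r.
  by apply: Vcomb => //; apply: Vaff; exact: affine_coord.
have formE (K : 'I_(ncell T)) ueps u v : H1 (icell K) ueps -> P1 T v ->
    ueps = post_process chi0 chi K u %[ae leb d in icell K] ->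
    a K ueps v = abar_quad a chi0 chi K u v.
  exact: (form_post_process nd (ha K) (@QH1 K) (@Qcomb K) (@Qaff K) (QW0 K) (QW K)).
have epsE i (K : 'I_(ncell T)) x :
    icell K x -> phieps i x = post_process chi0 chi K (phi i) x.
  by move=> Kx; rewrite (hphieps i K x Kx) post_process_correction.
have H1eps i (K : 'I_(ncell T)) : H1 (icell K) (phieps i).
  have hp := post_process_H1 (ha K) (@QH1 K) (@Qcomb K) (@Qaff K) (QW0 K) (QW K)
    (phi i).
  apply: H1_eq_on hp.
  by move=> x Kx; rewrite (epsE _ K).
split.
  apply/matrixP => j i; rewrite !mxE; apply: eq_bigr => K _.
  apply: formE; [exact: H1eps|exact: Pphi|].
  by apply: aeW => x Kx; exact: epsE.
have sumE (K : 'I_(ncell T)) (c : 'I_N0 -> R) u x :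
    eq_cells T u (fun y => \sum_i c i * phi_int i y) -> icell K x ->
    \sum_i c i * phieps_int i x = post_process chi0 chi K u x.
  move=> uE Kx; rewrite (post_process_sum chi0 chi nd K x (fun i => Pphi _) uE).
  by apply: eq_bigr => i _; rewrite -(epsE _ K).
move=> ueps; split.
- move=> [[bue [c ueE]] sol].
  pose uH x := \sum_i c i * phi_int i x.
  have pp K : ueps = post_process chi0 chi K uH %[ae leb d in icell K].
    by apply: filterS (ueE K) => x xE Kx; rewrite xE //; exact: sumE.
  exists uH; split; last by split.
  split; first exact: VH0_sum.
  move=> v hv; rewrite -sol //; apply: eq_bigr => K _.
  by apply/esym/formE; [exact: (bue.2 K)|exact: PVH0|exact: pp].
- move=> [uH [[VuH sol] [bue pp]]].
  split; last first.
    move=> v hv; rewrite -sol //; apply: eq_bigr => K _.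
    by apply: formE; [exact: (bue.2 K)|exact: PVH0|exact: pp].
  split => //; have [c [cE _]] := hspan _ VuH.
  exists (fun i => c 0 i) => K; apply: filterS (pp K) => x xE Kx.
  by rewrite xE // (sumE K _ _ _ cE Kx).
Qed.
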